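(* There exist absolute constants $C>0$ and $c>0$ such that every graph $G=([n],\mathcal{P})$ with $|\mathcal{P}|\ge C n^{3/2}$ contains an induced subgraph on at least $c\,\frac{|\mathcal{P}|}{n}$ vertices which is globally rigid in $\mathbb{R}$.
   Context: $[n]=\{1,\dots,n\}$ with $n\ge 1$, and $\mathcal{P}\subseteq\binom{[n]}{2}$ is the edge set of a simple graph. A graph $H$ with finite vertex set $X$ and edge set $E$ is globally rigid in $\mathbb{R}$ if for any two injective maps $f,g\colon X\to\mathbb{R}$ such that $|f(i)-f(j)|=|g(i)-g(j)|$ for every edge $\{i,j\}\in E$, one has $|f(i)-f(j)|=|g(i)-g(j)|$ for all pairs $\{i,j\}\in\binom{X}{2}$. *)

(* Defs.v *)
From mathcomp Require Import all_boot all_order all_algebra.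
From mathcomp Require Import reals exp.

Set Implicit Arguments.
Unset Strict Implicit.
Unset Printing Implicit Defensive.

Import Order.TTheory GRing.Theory Num.Theory.
Local Open Scope ring_scope.

(* A simple graph on the finite vertex type V is given by its edge set
   E : {set {set V}}, with E \subset vertex_pairs V. *)
Definition vertex_pairs (V : finType) : {set {set V}} :=
  [set e : {set V} | #|e| == 2%N].

(* The vertices of an induced subgraph form a subtype of V, so its edges are the
   sets of such vertices whose image in V is an edge. *)
Definition induced_edges (V : finType) (E : {set {set V}}) (S : {set V}) :
    {set {set {x : V | x \in S}}} :=
  [set e : {set {x : V | x \in S}} | val @: e \in E].

Definition globally_rigid (R : realType) (X : finType) (E : {set {set X}}) :
    Prop :=
  forall f g : X -> R, injective f -> injective g ->
    (forall i j : X, [set i; j] \in E -> `|f i - f j| = `|g i - g j|) ->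
    forall i j : X, [set i; j] \in vertex_pairs X ->
      `|f i - f j| = `|g i - g j|.

(* Main.v *)
Require Import Defs.
From mathcomp Require Import all_boot all_order all_algebra.
From mathcomp Require Import reals exp.
From mathcomp Require Import zify lra.
Set Implicit Arguments.
Unset Strict Implicit.
Unset Printing Implicit Defensive.

Import Order.TTheory GRing.Theory Num.Theory.
Local Open Scope ring_scope.

(** Given two injective placements f and g with the same edge lengths, send a
    vertex x to the point (f x - g x, f x + g x) of the plane.  Distinct
    vertices go to distinct points, and [|f i - f j| = |g i - g j|] says exactly
    that the points of i and j lie on a common horizontal or vertical line.
    Rigidity thus means that every such drawing of the graph, with all edges
    axis-parallel, lies on a single line.

    Two points that are not on a common axis-parallel line have only two common
    neighbours in the drawing, the other two corners of their rectangle.  Hence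
    two vertices a, b with at least three common neighbours lie on a common
    line, and all their common neighbours are on it too
    ([common_neighbours_aligned]).  Now fix an edge wa and glue along it all
    the complete bipartite graphs spanned by {a, b} and their common neighbours,
    where b ranges over the neighbours of w having at least three common
    neighbours with a: each piece lies on the line through w and a, so the
    union, called the book of (w, a), is globally rigid ([book_rigid]).

    It remains to find an edge wa with many such vertices b, which is an average
    over the m oriented edges.  There are [\sum_w deg(w)^2 >= m^2 / n] walks
    a, w, b.  Those with at most two common neighbours of a and b number at most
    2 n^2, and those with a = b number m; both are a small fraction of m^2 / n
    once m is at least a large multiple of n^(3/2).  So some oriented edge
    carries a constant multiple of m / n good walks ([exists_thick_edge]). *)

(** * Books of a graph *)

Definition neighbours (V : finType) (E : {set {set V}}) (x : V) : {set V} :=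
  [set y | [set x; y] \in E].

(** The threshold 2 is the number of points aligned, along different axes, with
    two given points in general position. *)
Definition partners (V : finType) (E : {set {set V}}) (w a : V) : {set V} :=
  [set b in neighbours E w |
    (b != a) && (2 < #|neighbours E a :&: neighbours E b|)%N].

Definition book (V : finType) (E : {set {set V}}) (w a : V) : {set V} :=
  a |: \bigcup_(b in partners E w a) (b |: (neighbours E a :&: neighbours E b)).

Lemma neighboursC (V : finType) (E : {set {set V}}) (x y : V) :
  (x \in neighbours E y) = (y \in neighbours E x).
Proof. by rewrite !inE setUC. Qed.

(** * Rigidity of books *)

(** If a and b differed in both coordinates, each common neighbour would be one
    of the two remaining corners of the rectangle that they span, and a third
    common neighbour could not exist. *)
Lemma common_neighbours_aligned (T : eqType) (X : finType) (E : {set {set X}})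
    (u v : X -> T) (a b : X) :
  (forall i j, u i = u j -> v i = v j -> i = j) ->
  (forall i j, [set i; j] \in E -> u i = u j \/ v i = v j) ->
  b != a -> (2 < #|neighbours E a :&: neighbours E b|)%N ->
  (forall y, y \in b |: (neighbours E a :&: neighbours E b) -> u y = u a) \/
  (forall y, y \in b |: (neighbours E a :&: neighbours E b) -> v y = v a).
Proof.
move=> inj_uv edge_uv neq_ba three.
have nbr y : y \in neighbours E a :&: neighbours E b ->
    (u a = u y \/ v a = v y) /\ (u b = u y \/ v b = v y).
  by rewrite !inE => /andP[/edge_uv ? /edge_uv ?].
have not_both : u a = u b -> v a = v b -> False.
  by move=> eu ev; case/eqP: neq_ba; apply: inj_uv.
case: (u a =P u b) => [eu|neu].
  left=> y /setU1P[-> //|/nbr[[ay|ay] [yb|yb]]]; try congruence.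
  by case: not_both => //; congruence.
case: (v a =P v b) => [ev|nev].
  right=> y /setU1P[-> //|/nbr[[ay|ay] [yb|yb]]]; congruence.
have corner y : y \in neighbours E a :&: neighbours E b ->
    u y = u a /\ v y = v b \/ u y = u b /\ v y = v a.
  by move=> /nbr[[?|?] [?|?]]; [congruence|left|right|congruence].
have [y1 [y2 [y3 [[m1 m2 m3] [/eqP n12 /eqP n23 /eqP n31]]]]] :=
  card_gt2P three.
exfalso; move: (corner _ m1) (corner _ m2) (corner _ m3).
move=> [] [? ?] [] [? ?] [] [? ?];
  first [ by apply: n12; apply: inj_uv; congruence
        | by apply: n23; apply: inj_uv; congruence
        | by apply: n31; apply: inj_uv; congruence ].
Qed.

(** The pages of a book all contain both ends of its spine wa, which are
    distinct points, so they cannot lie on lines of different directions. *)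
Lemma book_aligned (T : eqType) (X : finType) (E : {set {set X}})
    (u v : X -> T) (w a x : X) :
  (forall i j, u i = u j -> v i = v j -> i = j) ->
  (forall i j, [set i; j] \in E -> u i = u j \/ v i = v j) ->
  w != a -> a \in neighbours E w -> u w = u a ->
  x \in book E w a -> u x = u a.
Proof.
move=> inj_uv edge_uv /eqP neq_wa a_w uwa /setU1P[->//|/bigcupP[b]].
rewrite inE => /and3P[b_w neq_ba three] x_page.
have w_page : w \in b |: (neighbours E a :&: neighbours E b).
  by apply/setU1P; right; rewrite inE !(neighboursC _ w) a_w.
have [|line_v] := common_neighbours_aligned inj_uv edge_uv neq_ba three.
  exact.
by case: neq_wa; apply: inj_uv (line_v w w_page).
Qed.

Lemma book_rigid (R : realType) (X : finType) (E : {set {set X}}) (w a : X) :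
  E \subset vertex_pairs X -> a \in neighbours E w ->
  (forall x, x \in book E w a) -> globally_rigid R E.
Proof.
move=> /subsetP sEX a_w full f g inj_f inj_g same_len i j _.
pose u x := f x - g x; pose v x := f x + g x.
have inj_uv x y : u x = u y -> v x = v y -> x = y.
  by rewrite /u /v => eu ev; apply: inj_f; lra.
have edge_uv x y : [set x; y] \in E -> u x = u y \/ v x = v y.
  move=> /same_len/eqP; rewrite eqr_norm2 /u /v.
  by case/orP=> /eqP e; [left|right]; lra.
have neq_wa : w != a.
  have : [set w; a] \in E by move: a_w; rewrite inE.
  by move=> /sEX; rewrite inE cards2; case: (w != a).
have [eu|ev] : u w = u a \/ v w = v a by apply: edge_uv; move: a_w; rewrite inE.
  have line x : u x = u a by apply: book_aligned inj_uv edge_uv neq_wa a_w eu (full x).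
  have : u i = u j by rewrite !line.
  by rewrite /u => e; congr `|_|; lra.
have inj_vu x y : v x = v y -> u x = u y -> x = y by move=> *; apply: inj_uv.
have edge_vu x y : [set x; y] \in E -> v x = v y \/ u x = u y.
  by move=> /edge_uv[]; [right|left].
have line x : v x = v a by apply: book_aligned inj_vu edge_vu neq_wa a_w ev (full x).
have : v i = v j by rewrite !line.
by rewrite /v -(normrN (g i - g j)) => e; congr `|_|; lra.
Qed.

Lemma induced_edges_pairs (V : finType) (E : {set {set V}}) (S : {set V}) :
  E \subset vertex_pairs V ->
  induced_edges E S \subset vertex_pairs {x : V | x \in S}.
Proof.
move=> /subsetP sEV; apply/subsetP=> e; rewrite inE => /sEV.
by rewrite !inE card_imset //; apply: val_inj.
Qed.

Lemma induced_neighbours (V : finType) (E : {set {set V}}) (S : {set V})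
    (x y : {x : V | x \in S}) :
  (y \in neighbours (induced_edges E S) x) = (val y \in neighbours E (val x)).
Proof. by rewrite !inE imsetU1 imset_set1. Qed.

(** A book contains all the common neighbours that make its pages rigid, so
    passing to the induced subgraph leaves it a book. *)
Lemma induced_book_rigid (R : realType) (V : finType) (E : {set {set V}})
    (w a : V) :
  E \subset vertex_pairs V -> a \in neighbours E w ->
  (0 < #|partners E w a|)%N ->
  globally_rigid R (induced_edges E (book E w a)).
Proof.
move=> sEV a_w /card_gt0P[b0 b0P].
set S := book E w a.
have pageS b : b \in partners E w a ->
    b |: (neighbours E a :&: neighbours E b) \subset S.
  by move=> bP; apply: subsetU; rewrite (bigcup_max b) ?orbT.
have aS : a \in S by apply: setU11.
have wS : w \in S.
  apply: (subsetP (pageS _ b0P)); apply/setU1P; right.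
  move: b0P; rewrite inE => /andP[b0_w _].
  by rewrite in_setI !(neighboursC _ w) a_w.
pose w' : {x | x \in S} := exist _ w wS; pose a' : {x | x \in S} := exist _ a aS.
apply: (@book_rigid R _ _ w' a').
- exact: induced_edges_pairs.
- by rewrite induced_neighbours.
move=> x; have /setU1P[xa|/bigcupP[b bP x_page]] := valP x.
  by apply/setU1P; left; apply: val_inj.
have bS : b \in S by apply: (subsetP (pageS _ bP)); apply: setU11.
pose b' : {x | x \in S} := exist _ b bS.
apply/setU1P; right; apply/bigcupP; exists b'; last first.
  move: x_page; rewrite !in_setU1 !in_setI !induced_neighbours.
  by rewrite -(inj_eq val_inj).
move: (bP); rewrite inE => /and3P[b_w neq_ba three].
rewrite inE induced_neighbours b_w -(inj_eq val_inj) neq_ba /=.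
apply: leq_trans three _; rewrite -(card_imset _ val_inj).
apply/subset_leq_card/subsetP=> y y_ab.
have yS : y \in S by apply: (subsetP (pageS _ bP)); rewrite in_setU1 y_ab orbT.
apply/imsetP; exists (exist _ y yS) => //.
by rewrite in_setI !induced_neighbours -in_setI.
Qed.

Lemma partners_sub_book (V : finType) (E : {set {set V}}) (w a : V) :
  partners E w a \subset book E w a.
Proof.
apply/subsetP=> b bP; apply/setU1P; right; apply/bigcupP; exists b => //.
exact: setU11.
Qed.

(** * Counting walks of length two *)

Local Open Scope nat_scope.

Lemma sqr_sum_le (I : finType) (d : I -> nat) :
  (\sum_i d i) ^ 2 <= #|I| * \sum_i d i ^ 2.
Proof.
have -> : (\sum_i d i) ^ 2 = \sum_i \sum_j d i * d j.
  by rewrite -mulnn big_distrlr.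
have double : \sum_i \sum_j (d i ^ 2 + d j ^ 2) = 2 * (#|I| * \sum_i d i ^ 2).
  under eq_bigr => i _ do rewrite big_split sum_nat_const /=.
  by rewrite big_split /= sum_nat_const -big_distrr mul2n addnn.
rewrite -(leq_pmul2l (isT : 0 < 2)) -double big_distrr leq_sum // => i _.
by rewrite big_distrr leq_sum // => j _; apply: nat_Cauchy.
Qed.

Lemma card_edges_le (V : finType) (E : {set {set V}}) :
  E \subset vertex_pairs V -> #|E| <= \sum_w #|neighbours E w|.
Proof.
move=> /subsetP sEV.
have -> : \sum_w #|neighbours E w| =
    #|[set p : V * V | p.2 \in neighbours E p.1]|.
  rewrite -sum1dep_card -(pair_big_dep predT (fun w a => a \in neighbours E w)
    (fun _ _ => 1)) /=.
  by apply: eq_bigr => w _; rewrite sum1_card.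
apply: leq_trans (leq_imset_card (fun p : V * V => [set p.1; p.2]) _).
apply/subset_leq_card/subsetP=> e eE.
have := sEV e eE; rewrite inE => /cards2P[x [y [_ e_xy]]].
by apply/imsetP; exists (x, y); rewrite // !inE /= -e_xy.
Qed.

(** Grouped by its ends a and b instead of by its middle w, each pair (a, b)
    that counts does so at most twice. *)
Lemma thin_walks_le (V : finType) (E : {set {set V}}) :
  \sum_w \sum_(a in neighbours E w)
    #|[set b in neighbours E w | #|neighbours E a :&: neighbours E b| <= 2]|
  <= 2 * #|V| ^ 2.
Proof.
rewrite (exchange_big_dep xpredT) //=.
have -> : 2 * #|V| ^ 2 = \sum_(a : V) \sum_(b : V) 2.
  by rewrite !sum_nat_const mulnA mulnn mulnC.
apply: leq_sum => a _.
under eq_bigr => w _ do rewrite -sum1dep_card.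
rewrite (exchange_big_dep
  (fun b => #|neighbours E a :&: neighbours E b| <= 2)) /=; last first.
  by move=> w b _ /andP[].
rewrite big_mkcond; apply: leq_sum => b _; case: ifP => // thin.
rewrite sum1dep_card; apply: leq_trans thin; apply/subset_leq_card/subsetP=> w.
by rewrite inE => /and3P[a_w b_w _]; rewrite inE !(neighboursC _ w) a_w.
Qed.

(** If every oriented edge had fewer than [|E| / (2 n)] partners, then counting
    the walks of length two would give [2 m^2 <= m |E| + 4 n^3 + 2 n m], where m
    is the number of oriented edges; but the right side is at most
    [(1 + 1/4 + 1/2) m^2]. *)
Lemma exists_thick_edge (V : finType) (E : {set {set V}}) :
  E \subset vertex_pairs V -> 0 < #|V| -> 16 * #|V| ^ 3 <= #|E| ^ 2 ->
  exists w a, a \in neighbours E w /\ #|E| <= 2 * #|V| * #|partners E w a|.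
Proof.
move=> sEV n_gt0 dense.
case: (boolP [exists w, exists a, (a \in neighbours E w) &&
    (#|E| <= 2 * #|V| * #|partners E w a|)]).
  by case/existsP=> w /existsP[a /andP[a_w le]]; exists w, a.
rewrite negb_exists => /forallP few; exfalso.
set n := #|V| in n_gt0 dense few *; set p := #|E| in dense few *.
pose m := \sum_w #|neighbours E w|.
have le_pm : p <= m by apply: card_edges_le.
have few_partners w a : a \in neighbours E w ->
    2 * n * #|partners E w a| <= p.
  move=> a_w; move: (few w); rewrite negb_exists => /forallP/(_ a).
  by rewrite a_w /= -ltnNge => /ltnW.
have degree_le w a : #|neighbours E w| <= #|partners E w a| + 1 +
    #|[set b in neighbours E w | #|neighbours E a :&: neighbours E b| <= 2]|.
  rewrite -[X in _ <= _ + X + _](cards1 a).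
  have leq_setU3 (A B D : {set V}) : #|A :|: B :|: D| <= #|A| + #|B| + #|D|.
    by rewrite (leq_trans (leq_card_setU _ _)) // leq_add2r leq_card_setU.
  apply: leq_trans (leq_setU3 _ _ _).
  apply/subset_leq_card/subsetP=> b b_w; rewrite !in_setU in_set1 !inE.
  move: b_w; rewrite inE => -> /=.
  by case: eqP; rewrite ?orbT //= orbF ltnNge orNb.
have walks : 2 * n * \sum_w #|neighbours E w| ^ 2 <=
    m * p + 2 * n * m + 2 * n * (2 * n ^ 2).
  apply: leq_trans _ (leq_add (leqnn _)
    (leq_mul (leqnn (2 * n)) (thin_walks_le E))).
  rewrite /m !big_distrr big_distrl -!big_split /=; apply: leq_sum => w _.
  rewrite -mulnn mulnCA -sum_nat_const big_distrr /=.
  rewrite [2 * n * #|_| in leqRHS]mulnC -!sum_nat_const -!big_split /=.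
  apply: leq_sum => a a_w.
  have := leq_mul (leqnn (2 * n)) (degree_le w a).
  by have := few_partners w a a_w; lia.
have cauchy : m ^ 2 <= n * \sum_w #|neighbours E w| ^ 2 by apply: sqr_sum_le.
have p_ge : 4 * n <= p.
  rewrite -(leq_exp2r _ _ (isT : 0 < 2)); apply: leq_trans dense.
  by rewrite expnMn leq_mul // leq_pexp2l.
have : 0 < m by lia.
nia.
Qed.

(** * Rigid induced subgraphs of dense graphs *)

Local Open Scope ring_scope.

Theorem theorem1 (R : realType) :
  exists C c : R, [/\ 0 < C, 0 < c &
    forall (n : nat) (P : {set {set 'I_n}}),
      (1 <= n)%N -> P \subset vertex_pairs 'I_n ->
      C * n%:R `^ (3 / 2) <= #|P|%:R ->
      exists S : {set 'I_n},
        c * (#|P|%:R / n%:R) <= #|S|%:R /\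
        globally_rigid R (induced_edges P S)].
Proof.
(* The constant 4 squares to the 16 that the count of walks requires. *)
exists 4, (1 / 2); split; [lra | lra | move=> n P n_gt0 sPV dense].
have dense_nat : (16 * #|'I_n| ^ 3 <= #|P| ^ 2)%N.
  rewrite card_ord -(ler_nat R) natrM !natrX.
  have -> : n%:R ^+ 3 = (n%:R `^ (3 / 2)) ^+ 2 :> R.
    rewrite -[RHS]powR_mulrn ?powR_ge0 // -powRrM -powR_mulrn ?ler0n //.
    by congr (_ `^ _); lra.
  have : 0 <= n%:R `^ (3 / 2) :> R by apply: powR_ge0.
  by move: dense; nra.
have [|w [a [a_w many]]] := exists_thick_edge sPV _ dense_nat.
  by rewrite card_ord.
(* The spine end w enters the book through a page, so one must exist. *)
have P_gt0 : (0 < #|P|)%N.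
  by move: dense_nat; rewrite card_ord; case: #|P| => //; nia.
exists (book P w a); split; last first.
  apply: induced_book_rigid => //.
  by move: many; case: #|partners P w a| => //; lia.
have : (#|P| <= 2 * n * #|book P w a|)%N.
  apply: leq_trans many _; rewrite card_ord leq_mul //.
  exact: subset_leq_card (partners_sub_book _ _ _).
rewrite -(ler_nat R) !natrM mulrA => le.
rewrite ler_pdivrMr ?ltr0n //; lra.
Qed.
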